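(* For all $m\ge 2$ and $n\ge 4$, the generalized wheel graph $W_{m,n}=\overline{K}_m+C_n$, with vertex set $V$, satisfies $\operatorname{nim}(\mathrm{DNT}(W_{m,n}))=\operatorname{pty}(V)$.
   Context: The generalized wheel graph $W_{m,n}$ is the join $\overline{K}_m+C_n$ of the edgeless graph on $m$ vertices and the cycle graph on $n$ vertices, i.e. their disjoint union together with all edges between the two vertex sets; it has $m+n$ vertices. For a graph $G$ with vertex set $V$, a set $K\subseteq V$ is convex if it contains every vertex lying on any shortest path between two elements of $K$. The convex hull $[P]$ of $P\subseteq V$ is the smallest convex set containing $P$. For a finite set $A$, $\operatorname{pty}(A):=|A|\bmod 2\in\{0,1\}$. The game $\mathrm{DNT}(G)$: positions are the sets $P\subseteq V$ with $[V\setminus P]=V$; the starting position is $\emptyset$; the options of $P$ are the sets $P\cup\{v\}$ with $v\in V\setminus P$ and $[V\setminus(P\cup\{v\})]=V$. The nim-value of a position is defined recursively by $\operatorname{nim}(p)=\operatorname{mex}\{\operatorname{nim}(q): q\text{ an option of }p\}$, where $\operatorname{mex}(A)$ is the smallest nonnegative integer not in $A$; the nim-value of a game is that of its starting position. *)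

(* Defs.v *)
From mathcomp Require Import all_boot.

Set Implicit Arguments.
Unset Strict Implicit.
Unset Printing Implicit Defensive.

Definition pty (T : finType) (A : {set T}) : nat := #|A| %% 2.

(* A graph is a (symmetric, irreflexive) adjacency relation on a finType.     *)
Section Convexity.

Variables (T : finType) (e : rel T).

Definition path_between (x y : T) (p : seq T) : bool :=
  path e x p && (last x p == y).

(* The vertices of the path are those of x :: p, and its length is size p.    *)
Definition shortest_path (x y : T) (p : seq T) : bool :=
  path_between x y p &&
  [forall k : 'I_(size p), forall q : k.-tuple T, ~~ path_between x y q].

(* Only lengths below #|T| are tested, so that the quantifiers are finite;    *)
(* convexP shows that this loses nothing.                                     *)
Definition convex (K : {set T}) : bool :=
  [forall x in K, forall y in K, forall k : 'I_#|T|, forall p : k.-tuple T,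
     shortest_path x y p ==> [forall z, (z \in x :: p) ==> (z \in K)]].

Definition convex_hull (P : {set T}) : {set T} :=
  \bigcap_(K : {set T} | convex K && (P \subset K)) K.

Lemma shortest_pathP x y p :
  reflect (path_between x y p /\
           forall q, path_between x y q -> size p <= size q)
          (shortest_path x y p).
Proof.
apply: (iffP andP) => -[pxy minp]; split=> //.
  move=> q qxy; rewrite leqNgt; apply/negP => ltqp.
  have /forallP/(_ (in_tuple q)) := forallP minp (Ordinal ltqp).
  by rewrite qxy.
apply/forallP => k; apply/forallP => q; apply/negP => /minp.
by rewrite size_tuple leqNgt ltn_ord.
Qed.

Lemma shortest_path_size x y p : shortest_path x y p -> size p < #|T|.
Proof.
case/shortest_pathP => /andP[pp /eqP pl] minp.
case/shortenP: pp pl => q qp quniq _ ql.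
have le_pq : size p <= size q by apply: minp; rewrite /path_between qp ql /=.
apply: leq_ltn_trans le_pq _.
by have := max_card (mem (x :: q)); rewrite (card_uniqP quniq).
Qed.

Lemma convexP (K : {set T}) :
  reflect (forall x y p z, x \in K -> y \in K -> shortest_path x y p ->
             z \in x :: p -> z \in K)
          (convex K).
Proof.
apply: (iffP idP) => [cK x y p z xK yK sp zp | cK].
  have ltp := shortest_path_size sp.
  move/forall_inP/(_ x xK)/forall_inP/(_ y yK): cK.
  move/forallP/(_ (Ordinal ltp))/forallP/(_ (in_tuple p))/implyP/(_ sp).
  by move/forallP/(_ z)/implyP/(_ zp).
apply/forall_inP => x xK; apply/forall_inP => y yK.
apply/forallP => k; apply/forallP => p; apply/implyP => sp.
by apply/forallP => z; apply/implyP; apply: cK sp.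
Qed.

Lemma convex_convex_hull (P : {set T}) : convex (convex_hull P).
Proof.
apply/convexP => x y p z /bigcapP xH /bigcapP yH sp zp; apply/bigcapP => K hK.
have /andP[/convexP cK _] := hK.
by apply: cK sp zp; [exact: xH | exact: yH].
Qed.

Lemma sub_convex_hull (P : {set T}) : P \subset convex_hull P.
Proof. by apply/bigcapsP => K /andP[]. Qed.

Lemma convex_hull_min (P K : {set T}) :
  convex K -> P \subset K -> convex_hull P \subset K.
Proof. by move=> cK PK; apply: bigcap_inf; rewrite cK. Qed.

Lemma convex_hullT : convex_hull [set: T] = [set: T].
Proof. by apply/eqP; rewrite -subTset sub_convex_hull. Qed.

End Convexity.

Lemma mex_ex (s : seq nat) : exists n, n \notin s.
Proof.
exists (\max_(i <- s) i).+1; apply/negP => sn.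
have := @leq_bigmax_seq _ s xpredT id _ sn isT.
by rewrite ltnn.
Qed.

Definition mex (s : seq nat) : nat := ex_minn (mex_ex s).

Record game := Game {
  position : finType;
  start : position;
  is_option : rel position; (* is_option p q: q is an option of p *)
  option_wf : well_founded (fun q p => is_option p q)
}.

Definition nim_pos (G : game) : position G -> nat :=
  Fix (@option_wf G) (fun=> nat)
    (fun p nim_opt => mex [seq nim_opt (val q) (valP q)
                          | q : {q : position G | is_option p q}]).

Definition nim (G : game) : nat := nim_pos (start G).

Lemma nim_posE (G : game) (p : position G) :
  nim_pos p = mex [seq nim_pos q | q in is_option p].
Proof.
rewrite {1}/nim_pos Fix_eq => [|x f g fg].
  rewrite -/(@nim_pos G) /mex.
  apply: eq_ex_minn => n; congr (~~ _).
  apply/imageP/imageP => [[[q pq] _ ->] | [q pq ->]]; first by exists q.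
  by exists (exist _ q pq).
by congr mex; apply: eq_map => q; apply: fg.
Qed.

Section DoNotTerminate.

Variables (T : finType) (e : rel T).

Definition dnt_position (P : {set T}) : bool :=
  convex_hull e (~: P) == [set: T].

Definition dnt_option (P Q : {P : {set T} | dnt_position P}) : bool :=
  [exists v, (v \notin val P) && (val Q == v |: val P)].

Lemma dnt_start_subproof : dnt_position set0.
Proof. by rewrite /dnt_position setC0 convex_hullT. Qed.

Lemma dnt_option_wf : well_founded (fun Q P => dnt_option P Q).
Proof.
move=> P; have [n] := ubnP #|~: val P|.
elim: n P => [|n IHn] P; first by rewrite ltn0.
rewrite ltnS => lePn.
constructor=> Q /existsP[v /andP[vP /eqP valQ]]; apply: IHn.
apply: (leq_trans _ lePn); rewrite valQ; apply: proper_card.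
rewrite properE !setCS subsetUr /=; apply/subsetPn; exists v => //.
by rewrite setU11.
Qed.

Definition DNT : game :=
  Game (exist _ set0 dnt_start_subproof) dnt_option_wf.

End DoNotTerminate.

Definition edgeless_adj (m : nat) : rel 'I_m := fun _ _ => false.

(* ordS is the successor modulo n.                                            *)
Definition cycle_adj (n : nat) : rel 'I_n :=
  fun i j => (j == ordS i) || (i == ordS j).

Definition join_adj (T U : finType) (e : rel T) (f : rel U) : rel (T + U) :=
  fun x y => match x, y with
             | inl a, inl b => e a b
             | inr a, inr b => f a b
             | _, _ => true
             end.

Definition wheel_adj (m n : nat) : rel ('I_m + 'I_n) :=
  join_adj (@edgeless_adj m) (@cycle_adj n).

Arguments wheel_adj : clear implicits.

Lemma wheel_adj_sym m n : symmetric (wheel_adj m n).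
Proof. by case=> i [] j //=; rewrite /cycle_adj orbC. Qed.

Lemma wheel_adj_irr m n : 1 < n -> irreflexive (wheel_adj m n).
Proof.
move=> n_gt1 [] i //=; rewrite /cycle_adj orbb; apply/negbTE/eqP.
move/(congr1 val) => /= eqi; have := ltn_ord i; rewrite leq_eqVlt.
case/orP => [/eqP iS | iS]; last first.
  by move: eqi; rewrite modn_small // => /esym/eqP; rewrite eqn_leq ltnn.
by move: eqi n_gt1; rewrite iS modnn => i0; rewrite -iS i0.
Qed.

(* Main.v *)
(* Since m >= 2 and n >= 4, any two distinct nonadjacent vertices of W_{m,n}
   have the whole graph as their convex hull, whereas cliques are convex.  So a
   set of vertices is a position exactly when its complement contains two
   distinct nonadjacent vertices, and every play stops when exactly two
   vertices are left: the parity of the remaining number of moves is forced. *)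
Require Import Defs.
From mathcomp Require Import all_boot.

Set Implicit Arguments.
Unset Strict Implicit.
Unset Printing Implicit Defensive.

Lemma mexE (s : seq nat) (n : nat) :
  n \notin s -> (forall i, i < n -> i \in s) -> mex s = n.
Proof.
move=> ns lts; rewrite /mex; case: ex_minnP => k ks kmin.
apply/eqP; rewrite eqn_leq kmin // leqNgt; apply/negP => /lts.
by apply/negP.
Qed.

Section NonCliqueHull.

Variables (T : finType) (e : rel T).

Definition nonadjacent_pair (S : {set T}) : bool :=
  [exists x in S, exists y in S, (x != y) && ~~ e x y].

Lemma nonadjacent_pairP (S : {set T}) :
  reflect (exists x y, [/\ x \in S, y \in S, x != y & ~~ e x y])
          (nonadjacent_pair S).
Proof.
apply: (iffP exists_inP) => [[x xS /exists_inP[y yS /andP[]]]|[x [y []]]].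
  by exists x, y.
by move=> xS yS xy exy; exists x => //; apply/exists_inP; exists y; rewrite ?xy.
Qed.

(** Distinct vertices of a clique are joined by an edge, so a shortest path between them has length
    at most one and meets no third vertex. *)
Lemma convex_clique (S : {set T}) : ~~ nonadjacent_pair S -> convex e S.
Proof.
move/nonadjacent_pairP=> clS; apply/convexP => x y p z xS yS.
case/shortest_pathP=> /andP[_ /eqP pl] minp.
have [xy|xy] := eqVneq x y.
  have := minp [::]; rewrite /path_between /= xy eqxx => /(_ isT).
  by case: p pl {minp} => // _ _; rewrite inE => /eqP->.
have exy : e x y by apply/negPn/negP => exy; apply: clS; exists x, y.
have := minp [:: y]; rewrite /path_between /= exy eqxx => /(_ isT).
case: p pl {minp} => [|a [|b p]] //=; first by move/eqP: xy.
by move=> -> _; rewrite !inE => /orP[] /eqP->.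
Qed.

Lemma convex_common_neighbour (K : {set T}) (x y z : T) :
  convex e K -> x \in K -> y \in K -> x != y -> ~~ e x y ->
  e x z -> e z y -> z \in K.
Proof.
move=> /convexP cK xK yK xy exy xz zy.
apply: (cK x y [:: z; y]) => //; last by rewrite !inE eqxx orbT.
apply/shortest_pathP; split; first by rewrite /path_between /= xz zy eqxx.
(* A path of length 0 would force [x = y], one of length 1 an edge from [x] to [y]. *)
move=> [|a [|b q]] //=; rewrite /path_between /=; first by rewrite (negPf xy).
by rewrite andbT => /andP[xa /eqP ay]; rewrite -ay xa in exy.
Qed.

Hypothesis pairT : nonadjacent_pair [set: T].
Hypothesis hull_pair : forall K : {set T},
  convex e K -> nonadjacent_pair K -> K = [set: T].

Lemma dnt_positionE (P : {set T}) :
  dnt_position e P = nonadjacent_pair (~: P).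
Proof.
rewrite /dnt_position; apply/eqP/idP => [hullT | /nonadjacent_pairP[x [y [xP yP xy exy]]]].
  (* If the complement were a clique, it would be its own hull, hence all of [T], which [pairT]
     excludes. *)
  apply: contraT => clP; move: (clP).
  have := convex_hull_min (convex_clique clP) (subxx _).
  by rewrite hullT subTset => /eqP->; rewrite pairT.
apply: hull_pair; first exact: convex_convex_hull.
apply/nonadjacent_pairP; exists x, y; split=> //.
  exact: (subsetP (sub_convex_hull _ _)).
exact: (subsetP (sub_convex_hull _ _)).
Qed.

(** An odd complement is larger than its nonadjacent pair, so a third vertex can be selected while
    the pair stays unselected. *)
Lemma dnt_odd_has_option (P : position (DNT e)) :
  odd #|~: val P| -> exists Q : position (DNT e), is_option P Q.
Proof.
case: P => P /= Ppos oddP; have := Ppos.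
rewrite dnt_positionE => /nonadjacent_pairP[x [y [xP yP xy exy]]].
have [v vP] : exists v, v \in ~: P :\: [set x; y].
  apply/set0Pn; rewrite setD_eq0; apply/negP => sub.
  have eqP2 : ~: P = [set x; y].
    by apply/eqP; rewrite eqEsubset sub subUset !sub1set xP yP.
  by move: oddP; rewrite eqP2 cards2 xy.
move: vP; rewrite !inE negb_or => /andP[/andP[vx vy] vP].
have Qpos : dnt_position e (v |: P).
  rewrite dnt_positionE; apply/nonadjacent_pairP; exists x, y.
  rewrite !inE in xP yP *.
  by rewrite !negb_or xP yP xy exy (eq_sym x) (eq_sym y) vx vy.
by exists (exist _ (v |: P) Qpos); apply/existsP; exists v => /=; rewrite vP eqxx.
Qed.

Lemma dnt_option_card (P Q : position (DNT e)) :
  is_option P Q -> #|~: val P| = #|~: val Q|.+1.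
Proof.
case/existsP=> v /andP[vP /eqP ->].
by rewrite (cardsD1 v) inE vP setCU setIC -setDE.
Qed.

Lemma nim_pos_dnt (P : position (DNT e)) : nim_pos P = odd #|~: val P|.
Proof.
have [k] := ubnP #|~: val P|; elim: k P => // k IHk P.
rewrite ltnS => leP; rewrite nim_posE.
have nimQ (Q : position (DNT e)) :
    is_option P Q -> nim_pos Q = ~~ odd #|~: val P|.
  move=> PQ; rewrite IHk -?(dnt_option_card PQ) //.
  by rewrite (dnt_option_card PQ) /= negbK.
apply: mexE => [|i].
  by apply/imageP => -[Q /nimQ->]; case: odd.
(* Even case: there is no value below 0 to attain. Odd case: 0 must be attained, so an option has to
   exist. *)
case oddP: (odd _) => //; rewrite ltnS leqn0 => /eqP->.
have [Q PQ] := dnt_odd_has_option oddP.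
by apply/imageP; exists Q => //; rewrite (nimQ _ PQ) oddP.
Qed.

Lemma nim_dnt : nim (DNT e) = pty [set: T].
Proof. by rewrite /nim nim_pos_dnt /= setC0 /pty modn2. Qed.

End NonCliqueHull.

Lemma cycle_nonadjacent_pair (n : nat) :
  3 < n -> exists i j : 'I_n, i != j /\ ~~ cycle_adj i j.
Proof.
case: n => [|[|[|[|n]]]] // _.
(* The successor of 2 is 3, which does not wrap around to 0 on a cycle of length at least 4. *)
exists (@Ordinal n.+4 0 isT), (@Ordinal n.+4 2 isT).
by rewrite /cycle_adj -!val_eqE.
Qed.

(** Nonadjacent vertices lie on the same side of the join, and every vertex of the other side is a
    common neighbour of them. That other side then contains a nonadjacent pair too, which brings in
    the first side. *)
Lemma wheel_hull_pair (m n : nat) (K : {set 'I_m + 'I_n}) : 1 < m -> 3 < n ->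
  convex (wheel_adj m n) K -> nonadjacent_pair (wheel_adj m n) K ->
  K = [set: 'I_m + 'I_n].
Proof.
move=> hm hn cK /nonadjacent_pairP[x [y [xK yK xy exy]]].
have near := convex_common_neighbour cK.
have rim (a b : 'I_m) : a != b -> inl a \in K -> inl b \in K ->
    forall i, inr i \in K.
  by move=> ab aK bK i; apply: (near (inl a) (inl b)).
have hubs (i j : 'I_n) : i != j -> ~~ cycle_adj i j ->
    inr i \in K -> inr j \in K -> forall a, inl a \in K.
  by move=> ij eij iK jK a; apply: (near (inr i) (inr j)).
suff [hubK rimK] : (forall a, inl a \in K) /\ (forall i, inr i \in K).
  by apply/setP=> -[a|i]; rewrite inE ?hubK ?rimK.
case: x y xK yK xy exy => [a|i] [b|j] //= xK yK xy exy.
  have rimK := rim a b xy xK yK; split=> //.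
  have [i [j [ij eij]]] := cycle_nonadjacent_pair hn.
  exact: (hubs i j).
have hubK := hubs i j xy exy xK yK; split=> //.
exact: (rim (Ordinal (ltnW hm)) (Ordinal hm)).
Qed.

Theorem proposition5p32 (m n : nat) (hm : 2 <= m) (hn : 4 <= n) :
  nim (DNT (wheel_adj m n)) = pty [set: 'I_m + 'I_n].
Proof.
apply: nim_dnt => [|K]; last exact: wheel_hull_pair.
apply/nonadjacent_pairP.
by exists (inl (Ordinal (ltnW hm))), (inl (Ordinal hm)); rewrite !inE.
Qed.
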